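(* Let $(M,\eta,\xi,g,\Phi)$ be a Lorentzian Sasakian $3$-manifold. Every non-geodesic Legendre Frenet curve in $M$ is a contact whirl curve.
   Context: A contact metric Lorentzian $3$-manifold $(M,\eta,\xi,g,\Phi)$ is a smooth $3$-manifold with a contact form $\eta$, Reeb vector field $\xi$ ($\eta(\xi)=1$, $d\eta(\xi,\cdot)=0$), a Lorentzian metric $g$ with $g(\xi,\xi)=-1$, and a $(1,1)$-tensor $\Phi$ with $\Phi^2=-\mathrm{id}+\eta\otimes\xi$, $g(\Phi X,\Phi Y)=g(X,Y)+\eta(X)\eta(Y)$ and $d\eta(X,Y)=g(X,\Phi Y)$, where $d\eta(X,Y)=\tfrac12\bigl(X\eta(Y)-Y\eta(X)-\eta([X,Y])\bigr)$. In particular $\eta(X)=-g(X,\xi)$. It is Lorentzian Sasakian if $\xi$ is Killing (equivalently $h=\frac12\mathcal L_\xi\Phi=0$); then $\nabla_X\xi=\Phi X$ and $(\nabla_X\Phi)Y=g(X,Y)\xi+\eta(Y)X$, with $\nabla$ the Levi-Civita connection of $g$. A (non-geodesic) Frenet curve is a unit-speed non-null curve $\alpha$, with $T=\alpha'$ and $g(T,T)=\varepsilon_1\in\{\pm1\}$, such that $\nabla_TT$ is non-null. It has an orthonormal Frenet frame $\{T,N,B\}$, with $g(N,N)=\varepsilon_2$, $g(B,B)=\varepsilon_3$, $\varepsilon_1\varepsilon_2=-\varepsilon_3$, satisfying $$\nabla_TT=\varepsilon_2\kappa N,\quad \nabla_TN=-\varepsilon_1\kappa T-\varepsilon_3\tau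 B,\quad \nabla_TB=\varepsilon_2\tau N,$$ with curvature $\kappa>0$ and torsion $\tau$. The curve is Legendre if $\eta(T)=0$ along $\alpha$. It is a contact whirl curve if there is a constant $\varrho\neq0$ with $\eta(T)=\varrho\,\eta(N)$ along $\alpha$. *)

(* Defs.v *)
From mathcomp Require Import all_boot all_order all_algebra.
From mathcomp Require Import all_classical all_reals all_analysis.

Set Implicit Arguments.
Unset Strict Implicit.
Unset Printing Implicit Defensive.
Import Order.TTheory GRing.Theory Num.Theory.
Import numFieldNormedType.Exports.
Local Open Scope classical_set_scope.
Local Open Scope ring_scope.

(** * Smooth maps between normed spaces *)

(* For U open: f is k times continuously differentiable on U. *)
Fixpoint Ck_on {R : realType} {V W : normedModType R} (k : nat) (U : set V)
    (f : V -> W) : Prop :=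
  match k with
  | 0 => forall x, U x -> {for x, continuous f}
  | k'.+1 => (forall x, U x -> differentiable f x) /\
             (forall v, Ck_on k' U (fun x => 'd f x v))
  end.

Definition smooth_on {R : realType} {V W : normedModType R} (U : set V)
    (f : V -> W) : Prop := forall k, Ck_on k U f.

Definition smooth_near {R : realType} {V W : normedModType R} (x : V)
    (f : V -> W) : Prop := exists2 U, open_nbhs x U & smooth_on U f.

(** * Smooth 3-manifolds *)

(* [coord] and [param] are total functions, mutually inverse between [dom] and
   [cod]; their values elsewhere are irrelevant. *)
Record chart (R : realType) (M : topologicalType) := Chart {
  dom : set M;
  cod : set 'rV[R]_3;
  coord : M -> 'rV[R]_3;
  param : 'rV[R]_3 -> M;
  dom_open : open dom;
  cod_open : open cod;
  coord_cod : forall p, dom p -> cod (coord p);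
  param_dom : forall x, cod x -> dom (param x);
  coordK : forall p, dom p -> param (coord p) = p;
  paramK : forall x, cod x -> coord (param x) = x;
  coord_continuous : forall p, dom p -> {for p, continuous coord};
  param_continuous : forall x, cod x -> {for x, continuous param};
}.

(* As usual in formalized differential geometry, every point p comes with a
   preferred chart [chart_at p] of the atlas around it. *)
Record smooth_manifold3 (R : realType) := SmoothManifold3 {
  carrier :> topologicalType;
  carrier_hausdorff : hausdorff_space carrier;
  carrier_second_countable : @second_countable carrier;
  atlas : set (chart R carrier);
  chart_at : carrier -> chart R carrier;
  chart_at_atlas : forall p, atlas (chart_at p);
  chart_at_dom : forall p, dom (chart_at p) p;
  atlas_compatible : forall c d, atlas c -> atlas d ->
    smooth_on [set x | cod c x /\ dom d (param c x)] (coord d \o param c);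
}.

Section Manifold.
Context {R : realType} {M : smooth_manifold3 R}.

(* A tangent vector at p is given by its components in the chart [chart_at p];
   [dcoord] and [coord_field] convert to and from the other charts through the
   differentials of the transition maps. *)
Definition tangent (p : M) : Type := 'rV[R]_3.

Definition vfield : Type := forall p : M, tangent p.

(* Components in the chart c of a tangent vector at p. *)
Definition dcoord (c : chart R M) (p : M) (v : tangent p) : 'rV[R]_3 :=
  'd (coord c \o param (chart_at p) : 'rV[R]_3 -> 'rV[R]_3)
    (coord (chart_at p) p) v.

(* The vector field, meaningful on [dom c], with constant components w in the
   chart c. *)
Definition coord_field (c : chart R M) (w : 'rV[R]_3) : vfield := fun p =>
  'd (coord (chart_at p) \o param c : 'rV[R]_3 -> 'rV[R]_3) (coord c p) w.

Definition vfield_rep (c : chart R M) (X : vfield) (x : 'rV[R]_3) : 'rV[R]_3 :=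
  dcoord c (X (param c x)).

(* Smoothness on a neighbourhood of p of a function and of a vector field. *)
Definition smooth_fun_at (p : M) (f : M -> R) : Prop :=
  smooth_near (coord (chart_at p) p) (f \o param (chart_at p) : _ -> R^o).

Definition smooth_vfield_at (p : M) (X : vfield) : Prop :=
  smooth_near (coord (chart_at p) p) (vfield_rep (chart_at p) X).

(* The derivative u(f). *)
Definition dfun (f : M -> R) (p : M) (u : tangent p) : R :=
  'd (f \o param (chart_at p) : 'rV[R]_3 -> R^o) (coord (chart_at p) p) u.

(* The Lie bracket [X, Y], in coordinates DY(X) - DX(Y). *)
Definition bracket (X Y : vfield) : vfield := fun p =>
  let c := chart_at p in
  'd (vfield_rep c Y) (coord c p) (X p) - 'd (vfield_rep c X) (coord c p) (Y p).

(** * Lorentzian metrics and the Levi-Civita connection *)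

Record lorentzian_metric := LorentzianMetric {
  metric :> forall p : M, tangent p -> tangent p -> R;
  metric_linear : forall p (u : tangent p) a v w,
    metric u (a *: v + w) = a * metric u v + metric u w;
  metric_sym : forall p (u v : tangent p), metric u v = metric v u;
  (* signature (-, +, +) *)
  metric_signature : forall p, exists e : 'I_3 -> tangent p, forall i j,
    metric (e i) (e j) = if i == j then (if i == ord0 then -1 else 1) else 0;
  metric_smooth : forall p (X Y : vfield),
    smooth_vfield_at p X -> smooth_vfield_at p Y ->
    smooth_fun_at p (fun q => metric (X q) (Y q));
}.

(* [nabla p Y u] is the covariant derivative of Y at p in the direction u; it
   is only specified for Y smooth around p. *)
Definition connection_op : Type := 
  forall p : M, vfield -> tangent p -> tangent p.

Record affine_connection (nabla : connection_op) : Prop := AffineConnection {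
  nabla_linear : forall p (Y : vfield), smooth_vfield_at p Y ->
    forall a (u v : tangent p),
      nabla p Y (a *: u + v) = a *: nabla p Y u + nabla p Y v;
  nabla_add : forall p (Y Z : vfield),
    smooth_vfield_at p Y -> smooth_vfield_at p Z ->
    forall u : tangent p,
      nabla p (fun q => Y q + Z q) u = nabla p Y u + nabla p Z u;
  nabla_leibniz : forall p (f : M -> R) (Y : vfield),
    smooth_fun_at p f -> smooth_vfield_at p Y ->
    forall u : tangent p,
      nabla p (fun q => f q *: Y q) u = dfun f u *: Y p + f p *: nabla p Y u;
  nabla_smooth : forall p (X Y : vfield),
    smooth_vfield_at p X -> smooth_vfield_at p Y ->
    smooth_vfield_at p (fun q => nabla q Y (X q));
}.

Record levi_civita (g : lorentzian_metric) (nabla : connection_op) : Prop :=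
  LeviCivita {
  levi_civita_connection : affine_connection nabla;
  levi_civita_torsion_free : forall p (X Y : vfield),
    smooth_vfield_at p X -> smooth_vfield_at p Y ->
    nabla p Y (X p) - nabla p X (Y p) = bracket X Y p;
  levi_civita_metric : forall p (Y Z : vfield),
    smooth_vfield_at p Y -> smooth_vfield_at p Z ->
    forall u : tangent p,
      dfun (fun q => g q (Y q) (Z q)) u =
      g p (nabla p Y u) (Z p) + g p (Y p) (nabla p Z u);
}.

(* L_X g = 0. *)
Definition killing (g : lorentzian_metric) (X : vfield) : Prop :=
  forall p (Y Z : vfield), smooth_vfield_at p Y -> smooth_vfield_at p Z ->
    dfun (fun q => g q (Y q) (Z q)) (X p) =
    g p (bracket X Y p) (Z p) + g p (Y p) (bracket X Z p).

(** * Contact metric Lorentzian 3-manifolds *)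

Definition covfield : Type := forall p : M, {linear tangent p -> R^o}.

Definition ext_deriv (eta : covfield) (X Y : vfield) (p : M) : R :=
  2^-1 * (dfun (fun q => eta q (Y q)) (X p) - dfun (fun q => eta q (X q)) (Y p)
          - eta p (bracket X Y p)).

(* The 3-form eta /\ d eta, up to a nonzero constant factor. *)
Definition eta_wedge_deta (eta : covfield) (X Y Z : vfield) (p : M) : R :=
  eta p (X p) * ext_deriv eta Y Z p + eta p (Y p) * ext_deriv eta Z X p
  + eta p (Z p) * ext_deriv eta X Y p.

Record contact_form (eta : covfield) : Prop := ContactForm {
  contact_smooth : forall p (X : vfield), smooth_vfield_at p X ->
    smooth_fun_at p (fun q => eta q (X q));
  contact_nondegenerate : forall p, exists X Y Z : vfield,
    [/\ smooth_vfield_at p X, smooth_vfield_at p Y, smooth_vfield_at p Z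
      & eta_wedge_deta eta X Y Z p != 0];
}.

Record reeb_field (eta : covfield) (xi : vfield) : Prop := ReebField {
  reeb_smooth : forall p, smooth_vfield_at p xi;
  reeb_unit : forall p, eta p (xi p) = 1;
  reeb_kernel : forall p (X : vfield), smooth_vfield_at p X ->
    ext_deriv eta xi X p = 0;
}.

Record contact_metric_lorentzian := ContactMetricLorentzian {
  eta : covfield;
  xi : vfield;
  g : lorentzian_metric;
  Phi : forall p : M, {linear tangent p -> tangent p};
  eta_contact : contact_form eta;
  xi_reeb : reeb_field eta xi;
  Phi_smooth : forall p (X : vfield), smooth_vfield_at p X ->
    smooth_vfield_at p (fun q => Phi q (X q));
  xi_timelike : forall p, g p (xi p) (xi p) = -1;
  Phi_squared : forall p (u : tangent p),
    Phi p (Phi p u) = - u + eta p u *: xi p;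
  Phi_metric : forall p (u v : tangent p),
    g p (Phi p u) (Phi p v) = g p u v + eta p u * eta p v;
  deta_Phi : forall p (X Y : vfield),
    smooth_vfield_at p X -> smooth_vfield_at p Y ->
    ext_deriv eta X Y p = g p (X p) (Phi p (Y p));
}.

Definition lorentzian_sasakian (C : contact_metric_lorentzian) : Prop :=
  killing (g C) (xi C).

(** * Frenet curves *)

(* Curves are total functions on R, restricted to an open interval. *)
Definition curve_smooth_at (alpha : R -> M) (s : R) : Prop :=
  {for s, continuous alpha} /\
  smooth_near (s : R^o) (coord (chart_at (alpha s)) \o alpha : R^o -> 'rV[R]_3).

Definition vfield_along (alpha : R -> M) : Type := forall s, tangent (alpha s).

(* Components, in the chart c, of a vector field along a curve. *)
Definition along_rep (c : chart R M) (alpha : R -> M) (V : vfield_along alpha)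
    (t : R) : 'rV[R]_3 := dcoord c (V t).

Definition along_smooth_at (alpha : R -> M) (V : vfield_along alpha) (s : R)
    : Prop :=
  smooth_near (s : R^o)
    (along_rep (chart_at (alpha s)) V : R^o -> 'rV[R]_3).

Definition velocity (alpha : R -> M) : vfield_along alpha := fun s =>
  derive1 (coord (chart_at (alpha s)) \o alpha) s.

(* Covariant derivative of V along alpha. With V = \sum_k V^k d_k in the chart
   at alpha s, this is \sum_k (V^k)' d_k + \sum_k V^k nabla_T d_k at s. *)
Definition cov_deriv (nabla : connection_op) (alpha : R -> M)
    (V : vfield_along alpha) : vfield_along alpha := fun s =>
  let c := chart_at (alpha s) in
  derive1 (along_rep c V) s + nabla (alpha s) (coord_field c (V s)) (velocity alpha s).

Record frenet_curve (g : lorentzian_metric) (nabla : connection_op) :=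
  FrenetCurve {
  curve : R -> M;
  idom : set R;
  fN : vfield_along curve;
  fB : vfield_along curve;
  eps1 : R;
  eps2 : R;
  eps3 : R;
  kappa : R -> R;
  tau : R -> R;
  fT := velocity curve;
  fcov := @cov_deriv nabla curve;
  idom_open : open idom;
  idom_interval : is_interval idom;
  idom_nonempty : idom !=set0;
  curve_smooth : forall s, idom s -> curve_smooth_at curve s;
  fN_smooth : forall s, idom s -> along_smooth_at fN s;
  fB_smooth : forall s, idom s -> along_smooth_at fB s;
  eps1_sign : eps1 = 1 \/ eps1 = -1;
  eps2_sign : eps2 = 1 \/ eps2 = -1;
  eps3_sign : eps3 = 1 \/ eps3 = -1;
  eps_rel : eps1 * eps2 = - eps3;
  curve_unit_speed : forall s, idom s -> g (curve s) (fT s) (fT s) = eps1;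
  curve_accel_nonnull : forall s, idom s -> g (curve s) (fcov fT s) (fcov fT s) != 0;
  frame_NN : forall s, idom s -> g (curve s) (fN s) (fN s) = eps2;
  frame_BB : forall s, idom s -> g (curve s) (fB s) (fB s) = eps3;
  frame_TN : forall s, idom s -> g (curve s) (fT s) (fN s) = 0;
  frame_TB : forall s, idom s -> g (curve s) (fT s) (fB s) = 0;
  frame_NB : forall s, idom s -> g (curve s) (fN s) (fB s) = 0;
  kappa_gt0 : forall s, idom s -> 0 < kappa s;
  frenet_T : forall s, idom s -> fcov fT s = (eps2 * kappa s) *: fN s;
  frenet_N : forall s, idom s ->
    fcov fN s = - (eps1 * kappa s) *: fT s - (eps3 * tau s) *: fB s;
  frenet_B : forall s, idom s -> fcov fB s = (eps2 * tau s) *: fN s;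
}.

Definition legendre (eta : covfield) (g : lorentzian_metric)
    (nabla : connection_op) (c : frenet_curve g nabla) : Prop :=
  forall s, idom c s -> eta (curve c s) (fT c s) = 0.

Definition contact_whirl (eta : covfield) (g : lorentzian_metric)
    (nabla : connection_op) (c : frenet_curve g nabla) : Prop :=
  exists2 rho : R, rho != 0 &
    forall s, idom c s ->
      eta (curve c s) (fT c s) = rho * eta (curve c s) (fN c s).

End Manifold.

Arguments vfield {R} M.
Arguments lorentzian_metric {R} M.
Arguments connection_op {R} M.
Arguments covfield {R} M.
Arguments contact_metric_lorentzian {R} M.

(* Main.v *)
Require Import Defs.
From mathcomp Require Import all_boot all_order all_algebra.
From mathcomp Require Import all_classical all_reals all_analysis.
From mathcomp Require Import lra.

(** Along a Legendre curve [eta T] vanishes identically, so it is enough to see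
    that [eta N] vanishes too: the ratio 1, like any other nonzero one, then
    works.

    Since [eta X = - g (X, xi)] and the connection is metric, differentiating
    [eta V] along a curve with tangent T gives
      [(eta V)' = eta (nabla_T V) - g (nabla_T xi, V)]
    ([derive_eta_cov_deriv]).  For V = T the last term vanishes, because the
    Killing condition says that [u |-> nabla_u xi] is skew for the metric
    ([killing_nabla_skew]).  With [eta T = 0] this leaves
    [0 = eta (nabla_T T) = eps2 * kappa * eta N], and [kappa > 0].

    The remaining work is to justify the displayed product rule in charts.  A
    vector field V along the curve is expanded in the coordinate frame of the
    chart at the point considered.  The functions [eta] of the frame fields are
    smooth, so the Leibniz rule and the chain rule express [(eta V)'] through
    the derivatives of the components of V and the derivative of [eta] of the
    coordinate field with frozen components ([derive_eta_along]); the latter is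
    given by the Levi-Civita connection ([dfun_eta]).  Each tangent space is
    expressed in its own preferred chart, so moving along the curve requires the
    invertibility of the transition differentials ([transition_diffK]) and, for
    V = T, the fact that the components of the velocity in a fixed chart are the
    derivatives of the coordinates of the curve ([is_derive_coord_curve]). *)

Set Implicit Arguments.
Unset Strict Implicit.
Unset Printing Implicit Defensive.
Import Order.TTheory GRing.Theory Num.Theory.
Import numFieldNormedType.Exports.
(* [coord] denotes the coordinate map of a chart again, not the coordinates of
   a vector in a basis. *)
Import Defs.
Local Open Scope classical_set_scope.
Local Open Scope ring_scope.

(** * Germs of differentiable and smooth maps *)

Section Germs.
Context {R : realType} {V W : normedModType R}.
Implicit Types f g : V -> W.

(** The differential depends only on the germ; every computation in charts uses
    this, since identities between charts hold on their domains only. *)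
Lemma near_eq_is_diff f g (x : V) (df : V -> W) :
  (\near x, f x = g x) -> is_diff x f df -> is_diff x g df.
Proof.
move=> fg [dfx <-].
suff gE : g \o shift x = cst (g x) + 'd f x +o_ (0 : V) id.
  have dg : 'd g x = 'd f x :> (V -> W).
    by apply: diff_unique gE; exact: diff_continuous.
  apply: DiffDef => //; apply/diff_locallyP; rewrite dg; split => //.
  exact: diff_continuous.
have := diff_locally dfx.
move=> /eqaddoP fo; apply/eqaddoP => e e0.
have fg0 : \forall h \near (0 : V), f (h + x) = g (h + x).
  by move: (fg); rewrite (near_shift 0 x) subr0.
near=> h.
have <- : (f \o shift x - (cst (f x) + 'd f x)) h =
          (g \o shift x - (cst (g x) + 'd f x)) h.
  rewrite !fctE /= (nbhs_singleton fg); congr (_ - _).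
  by near: h.
by near: h; exact: fo.
Unshelve. all: by end_near. Qed.

(** The differential of f vanishes on U in every direction, so the induction
    continues with the constant 0. *)
Lemma Ck_on_cst k (U : set V) f (w : W) :
  open U -> (forall x, U x -> f x = w) -> Ck_on k U f.
Proof.
move=> oU; elim: k f w => [|k IH] f w fw /=.
- move=> x Ux; apply: differentiable_continuous.
  have : is_diff x f (0 : V -> W).
    apply: (@near_eq_is_diff (cst w)) _.
    by apply: filterS (open_nbhs_nbhs (conj oU Ux)) => y /fw.
  by case.
- have H x : U x -> is_diff x f (0 : V -> W).
    move=> Ux; apply: (@near_eq_is_diff (cst w)) _.
    by apply: filterS (open_nbhs_nbhs (conj oU Ux)) => y /fw.
  split=> [x /H []//|v]; apply: (IH _ 0) => x /H Hx.
  by rewrite diff_val.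
Qed.

Lemma smooth_near_cst (x : V) f w : (\near x, f x = w) -> smooth_near x f.
Proof.
move=> fw; have : nbhs x [set y | f y = w] by [].
rewrite nbhsE => -[U oUx {}fw]; exists U => // k.
by apply: (@Ck_on_cst _ _ _ w) => //; case: oUx.
Qed.

Lemma smooth_near_differentiable (x : V) f : smooth_near x f -> differentiable f x.
Proof. by case=> U [oU Ux] /(_ 1%N) [H _]; exact: H. Qed.

Lemma smooth_near_diff (x : V) f v : smooth_near x f ->
  smooth_near x (fun y => 'd f y v).
Proof. by case=> U oU sf; exists U => // k; have [_] := sf k.+1; apply. Qed.

End Germs.

(** * Changes of charts and coordinate fields *)

Section Charts.
Context {R : realType} {M : smooth_manifold3 R}.
Implicit Types (c d : chart R M) (p q : M).

Lemma near_cod c p : dom c p -> \forall x \near coord c p, cod c x.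
Proof.
move=> cp; apply: open_nbhs_nbhs; split; first exact: cod_open.
exact: coord_cod.
Qed.

Lemma near_coord c p (P : M -> Prop) : dom c p -> (\near p, P p) ->
  \forall x \near coord c p, cod c x /\ P (param c x).
Proof.
move=> cp Pp; have cx := coord_cod cp.
have Px : \forall x \near coord c p, P (param c x).
  by apply: (param_continuous cx); rewrite coordK.
by apply: filterS2 (near_cod cp) Px => x.
Qed.

Lemma transition_differentiable c d p : atlas c -> atlas d ->
  dom c p -> dom d p ->
  differentiable (coord d \o param c : 'rV[R]_3 -> 'rV[R]_3) (coord c p).
Proof.
move=> ac ad cp dp.
have /(_ 1%N) [+ _] := atlas_compatible ac ad.
apply; split; first exact: coord_cod.
by rewrite coordK.
Qed.

(** The two transition maps are inverse to each other near the point, hence so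
    are their differentials by the chain rule. *)
Lemma transition_diffK c d p (v : 'rV[R]_3) : atlas c -> atlas d ->
  dom c p -> dom d p ->
  'd (coord c \o param d : 'rV[R]_3 -> 'rV[R]_3) (coord d p)
    ('d (coord d \o param c : 'rV[R]_3 -> 'rV[R]_3) (coord c p) v) = v.
Proof.
move=> ac ad cp dp.
have dcd := transition_differentiable ac ad cp dp.
have ddc := transition_differentiable ad ac dp cp.
have pE : coord d p = (coord d \o param c) (coord c p) by rewrite /= coordK.
rewrite pE in ddc *.
have := diff_comp dcd ddc => /(congr1 (fun h => h v)) /= <-.
have idE : \forall x \near coord c p, x =
   ((coord c \o param d) \o (coord d \o param c)) x.
  near=> x; have [cx dx] : cod c x /\ dom d (param c x).
    near: x; apply: near_coord cp _.
    by apply: open_nbhs_nbhs; split=> //; exact: dom_open.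
  by rewrite /= coordK// paramK.
have [_ ->] := near_eq_is_diff idE (is_diff_id _).
by [].
Unshelve. all: by end_near. Qed.

Lemma dcoord_coord_field c w q : atlas c -> dom c q ->
  dcoord c (coord_field c w q) = w.
Proof.
move=> ac cq; apply: transition_diffK => //; first exact: chart_at_atlas.
exact: chart_at_dom.
Qed.

Lemma coord_field_dcoord c q (v : tangent q) : atlas c -> dom c q ->
  coord_field c (dcoord c v) q = v.
Proof.
move=> ac cq; apply: transition_diffK => //; first exact: chart_at_atlas.
exact: chart_at_dom.
Qed.

Lemma coord_field_sum c (w : 'rV[R]_3) q :
  coord_field c w q = \sum_k w 0 k *: coord_field c (delta_mx 0 k) q.
Proof.
rewrite {1}/coord_field [w in LHS]row_sum_delta linear_sum.
by apply: eq_bigr => k _; rewrite linearZ.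
Qed.

Lemma dcoord_self p (v : tangent p) : dcoord (chart_at p) v = v.
Proof.
rewrite /dcoord.
have := chart_at_dom p; set c := chart_at p => cp.
have idE : \forall x \near coord c p, x = (coord c \o param c) x.
  by apply: filterS (near_cod cp) => x cx; rewrite /= paramK.
by have [_ ->] := near_eq_is_diff idE (is_diff_id _).
Qed.

Lemma coord_field_self p (w : 'rV[R]_3) : coord_field (chart_at p) w p = w.
Proof. exact: dcoord_self. Qed.

(** In its own chart a coordinate field has constant components. *)
Lemma coord_field_smooth p (w : 'rV[R]_3) :
  smooth_vfield_at p (coord_field (chart_at p) w).
Proof.
apply: (@smooth_near_cst _ _ _ _ _ w).
apply: filterS (near_cod (chart_at_dom p)) => x cx.
rewrite /vfield_rep dcoord_coord_field //; first exact: chart_at_atlas.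
exact: param_dom.
Qed.

End Charts.

(** * The contact form and the Levi-Civita connection *)

Section Sasakian.
Context {R : realType} {M : smooth_manifold3 R}.
Context (C : contact_metric_lorentzian M).

(** The Reeb condition [d eta (xi, X) = 0] says that [xi] is orthogonal to the
    image of [Phi]; apply this to [Phi (Phi u) = - u + eta u *: xi]. *)
Lemma eta_metric p (u : tangent p) : eta C p u = - g C p (xi C p) u.
Proof.
have gPhi (w : tangent p) : g C p (xi C p) (Phi C p w) = 0.
  have sw := coord_field_smooth p w.
  have := deta_Phi C (reeb_smooth (xi_reeb C) p) sw.
  by rewrite (reeb_kernel (xi_reeb C) sw) coord_field_self.
have g0 : g C p (xi C p) 0 = 0.
  by have := metric_linear (g C) (xi C p) 1 0 0; rewrite scaler0 addr0; lra.
have := gPhi (Phi C p u).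
rewrite Phi_squared addrC metric_linear.
rewrite -[- u]addr0 -scaleN1r metric_linear xi_timelike g0.
lra.
Qed.

(** Metric compatibility for [eta Y = - g (xi, Y)]. *)
Lemma dfun_eta (nabla : connection_op M) (hnabla : levi_civita (g C) nabla)
    p (Y : vfield M) (u : tangent p) : smooth_vfield_at p Y ->
  dfun (fun q => eta C q (Y q)) u =
  eta C p (nabla p Y u) - g C p (nabla p (xi C) u) (Y p).
Proof.
move=> sY; have sxi := reeb_smooth (xi_reeb C) p.
have -> : (fun q => eta C q (Y q)) = - (fun q => g C q (xi C q) (Y q)).
  by apply/funext => q; rewrite eta_metric.
have dg := smooth_near_differentiable (metric_smooth (g C) sxi sY).
have -> : dfun (- (fun q => g C q (xi C q) (Y q))) u =
    - dfun (fun q => g C q (xi C q) (Y q)) u.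
  exact: (congr1 (fun h => h u) (diffN dg)).
by rewrite (levi_civita_metric hnabla sxi sY u) opprD eta_metric addrC.
Qed.

(** Write [xi (g (Y, Y))] once with metric compatibility and once with the
    Killing condition: as the torsion vanishes, [[xi, Y] = nabla_xi Y - nabla_Y xi]
    and the difference is [2 g (nabla_Y xi, Y)].  Every tangent vector is the value
    of a smooth field Y. *)
Lemma killing_nabla_skew (nabla : connection_op M)
    (hnabla : levi_civita (g C) nabla) p (u : tangent p) : lorentzian_sasakian C ->
  g C p (nabla p (xi C) u) u = 0.
Proof.
move=> kxi; have sxi := reeb_smooth (xi_reeb C) p.
pose Y := coord_field (chart_at p) u; have Yp : Y p = u by exact: coord_field_self.
have sY : smooth_vfield_at p Y by exact: coord_field_smooth.
have := kxi p Y Y sY sY.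
rewrite (levi_civita_metric hnabla sY sY) -(levi_civita_torsion_free hnabla sxi sY).
rewrite Yp.
set a := nabla p Y _; set b := nabla p _ u.
have gB v : g C p (a - b) v = g C p a v - g C p b v.
  rewrite !(metric_sym _ _ v) addrC -scaleN1r metric_linear; lra.
by rewrite [X in _ = _ + X]metric_sym gB [X in _ + X = _]metric_sym; lra.
Qed.

End Sasakian.

(** * Differentiation along a curve *)

Section Curves.
Context {R : realType} {M : smooth_manifold3 R}.
Implicit Types (alpha : R -> M) (s : R).

Lemma near_dom_curve alpha s : {for s, continuous alpha} ->
  \forall t \near s, dom (chart_at (alpha s)) (alpha t).
Proof.
move=> ca; apply: ca; apply: open_nbhs_nbhs; split; first exact: dom_open.
exact: chart_at_dom.
Qed.

(** The velocity is defined in the chart at the point; the chain rule carries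
    this to any other chart. *)
Lemma is_derive_coord_curve alpha s (d : chart R M) : atlas d -> dom d (alpha s) ->
  curve_smooth_at alpha s ->
  is_derive s 1 (coord d \o alpha) (dcoord d (velocity alpha s)).
Proof.
move=> ad ds [ca sa]; pose c := chart_at (alpha s).
have dac : differentiable (coord c \o alpha : R^o -> _) s.
  exact: smooth_near_differentiable sa.
have dtr := transition_differentiable (chart_at_atlas _) ad (chart_at_dom _) ds.
have dcomp := differentiable_comp dac dtr.
have E : \forall t \near s,
    (coord d \o param c \o (coord c \o alpha)) t = (coord d \o alpha) t.
  by apply: filterS (near_dom_curve ca) => t ct; rewrite /= coordK.
apply: (near_eq_is_derive E).
apply: DeriveDef; first exact: diff_derivable.
by rewrite deriveE// diff_comp// /dcoord /velocity derive1E'.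
Qed.

End Curves.

Section AtPoint.
Context {R : realType} {M : smooth_manifold3 R} (alpha : R -> M) (s : R).

Let c := chart_at (alpha s).

Let ac : atlas c.
Proof. exact: chart_at_atlas. Qed.

(** In the chart at [alpha s], the components of the velocities at nearby points
    are the derivatives of the coordinates of the curve. *)
Lemma derivable_along_velocity :
  (\forall t \near s, curve_smooth_at alpha t) ->
  derivable (along_rep c (velocity alpha)) s 1.
Proof.
move=> sa; have [ca [U oU sU]] := nbhs_singleton sa.
have dU := open_nbhs_nbhs oU.
have E : \forall t \near s,
    'd (coord c \o alpha : R^o -> _) t 1 = along_rep c (velocity alpha) t.
  near=> t.
  have at_ : curve_smooth_at alpha t by near: t.
  have ct : dom c (alpha t) by near: t; exact: near_dom_curve.
  have dt : differentiable (coord c \o alpha : R^o -> _) t.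
    have Ut : U t by near: t.
    by have [+ _] := sU 1%N; apply.
  by rewrite -deriveE//; have [] := is_derive_coord_curve ac ct at_.
apply: (near_eq_derivable E).
apply: diff_derivable.
apply: smooth_near_differentiable; apply: smooth_near_diff.
by exists U.
Unshelve. all: by end_near. Qed.

(** The Leibniz rule for the pairing of a 1-form and a field along a curve: the
    second term differentiates the coefficients of the form while the components
    of V stay frozen. *)
Lemma derive_eta_along (eta : covfield M) (V : vfield_along alpha) :
  contact_form eta -> curve_smooth_at alpha s ->
  derivable (along_rep c V) s 1 ->
  'D_1 (fun t => eta (alpha t) (V t)) s =
  eta (alpha s) (derive1 (along_rep c V) s) +
  dfun (fun q => eta q (coord_field c (V s) q)) (velocity alpha s).
Proof.
move=> ceta sa dV; have [ca _] := sa.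
(* the coefficients of eta in the chart c *)
pose a k x := eta (param c x) (coord_field c (delta_mx 0 k) (param c x)).
have da k : differentiable (a k : _ -> R^o) (coord c (alpha s)).
  exact: smooth_near_differentiable (contact_smooth ceta (coord_field_smooth _ _)).
have aE w q : dom c q ->
    eta q (coord_field c w q) = \sum_k w 0 k * a k (coord c q).
  move=> cq; rewrite coord_field_sum linear_sum; apply: eq_bigr => k _.
  by rewrite linearZ /a coordK.
have cs : dom c (alpha s) by exact: chart_at_dom.
have E : \forall t \near s,
    (\sum_k (fun t => along_rep c V t 0 k * a k (coord c (alpha t)))) t
    = eta (alpha t) (V t).
  apply: filterS (near_dom_curve ca) => t ct.
  by rewrite fct_sumE -aE// coord_field_dcoord.
rewrite -(near_eq_derive _ E).
have vel := is_derive_coord_curve ac cs sa.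
rewrite dcoord_self in vel.
have dak k : is_derive s 1 (fun t => a k (coord c (alpha t)))
    ('d (a k : _ -> R^o) (coord c (alpha s)) (velocity alpha s)).
  have dal : differentiable (coord c \o alpha : R^o -> _) s.
    by apply/derivable1_diffP; case: vel.
  apply: DeriveDef.
    by apply: diff_derivable; exact: (differentiable_comp dal (da k)).
  rewrite [LHS](deriveE _ (differentiable_comp dal (da k))) diff_comp//=.
  have velE : 'd (coord c \o alpha : R^o -> _) s 1 = velocity alpha s.
    by rewrite -deriveE//; case: vel.
  by rewrite [X in 'd _ _ X]velE.
have dVk k : is_derive s 1 (fun t => along_rep c V t 0 k)
    (derive1 (along_rep c V) s 0 k).
  apply: DeriveDef; first exact: (derivable_mxP _ _ _).1.
  by rewrite derive1E derive_mx// mxE.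
rewrite derive_val.
have -> : eta (alpha s) (derive1 (along_rep c V) s) =
    \sum_k derive1 (along_rep c V) s 0 k * a k (coord c (alpha s)).
  by rewrite -aE// coord_field_self.
have -> : dfun (fun q => eta q (coord_field c (V s) q)) (velocity alpha s) =
    \sum_k (V s : 'rV[R]_3) 0 k *
      'd (a k : _ -> R^o) (coord c (alpha s)) (velocity alpha s).
  rewrite /dfun -deriveE; last first.
    exact: smooth_near_differentiable (contact_smooth ceta (coord_field_smooth _ _)).
  rewrite (_ : _ \o _ = \sum_k ((V s : 'rV[R]_3) 0 k \*: (a k : _ -> R^o))); last first.
    apply/funext => x; rewrite fct_sumE /= coord_field_sum linear_sum.
    by apply: eq_bigr => k _; rewrite linearZ.
  rewrite derive_sum => [|k]; last by apply: derivableZ; exact: diff_derivable.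
  apply: eq_bigr => k _; rewrite deriveZ; last exact: diff_derivable.
  by rewrite deriveE.
rewrite -big_split; apply: eq_bigr => k _ /=.
rewrite /along_rep dcoord_self addrC.
congr (_ + _); exact: mulrC.
Qed.

(** Differentiating [eta V = - g (xi, V)] along the curve. *)
Lemma derive_eta_cov_deriv (C : contact_metric_lorentzian M)
    (nabla : connection_op M) (hnabla : levi_civita (g C) nabla)
    (V : vfield_along alpha) :
  curve_smooth_at alpha s -> derivable (along_rep c V) s 1 ->
  'D_1 (fun t => eta C (alpha t) (V t)) s =
  eta C (alpha s) (cov_deriv nabla V s) -
  g C (alpha s) (nabla (alpha s) (xi C) (velocity alpha s)) (V s).
Proof.
move=> sa dV; rewrite (derive_eta_along (eta_contact C))//.
rewrite (dfun_eta hnabla)//; last exact: coord_field_smooth.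
by rewrite coord_field_self /cov_deriv linearD addrA.
Qed.

End AtPoint.

(** * Legendre curves *)

Theorem proposition3p6 (R : realType) (M : smooth_manifold3 R)
    (C : contact_metric_lorentzian M) (nabla : connection_op M)
    (hnabla : levi_civita (g C) nabla) (hC : lorentzian_sasakian C)
    (alpha : frenet_curve (g C) nabla) (hL : legendre (eta C) alpha) :
  contact_whirl (eta C) alpha.
Proof.
exists 1; first exact: oner_neq0.
move=> s Is; rewrite mul1r hL//.
have nearI : \forall t \near s, idom alpha t.
  by apply: open_nbhs_nbhs; split=> //; exact: idom_open.
have sa : \forall t \near s, curve_smooth_at (curve alpha) t.
  by apply: filterS nearI => t; exact: curve_smooth.
have := derive_eta_cov_deriv hnabla (nbhs_singleton sa) (derivable_along_velocity sa).
rewrite killing_nabla_skew// subr0.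
have -> : 'D_1 (fun t => eta C (curve alpha t) (velocity (curve alpha) t)) s = 0.
  have E : \forall t \near s, 0 = eta C (curve alpha t) (velocity (curve alpha) t).
    by apply: filterS nearI => t /hL.
  by rewrite -(near_eq_derive _ E) derive_cst.
rewrite [cov_deriv _ _ _](frenet_T Is) linearZ => /esym/eqP.
rewrite /= scaler_eq0 mulf_eq0 (gt_eqF (kappa_gt0 Is)) orbF.
case/orP => [/eqP e2|/eqP -> //].
by have [] := eps2_sign alpha; rewrite e2 => /eqP; rewrite eq_sym ?oppr_eq0 oner_eq0.
Qed.
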